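(* Let $C=(C_\bullet,b,B)$ and $\bar C=(\bar C_\bullet,b,B)$ be mixed complexes of $k$-modules. Let $f:C_\bullet\to\bar C_\bullet$ and $g:\bar C_\bullet\to C_\bullet$ be $k$-linear maps commuting with $b$, and $\varphi:C_\bullet\to C_{\bullet+1}$ a $k$-linear map, such that $fg=1$ and $gf=1+b\varphi+\varphi b$. Assume further that $f$ is a map of mixed complexes (i.e. it also commutes with $B$) and $f\varphi=0$. Let $g^\natural,\varphi^\natural$ be as defined in the context. Then: (i) $g^\natural:\bar C^\natural_\bullet\to C^\natural_\bullet$ is an $S$-map and a co-extension of $g$. (ii) We have $$fg^\natural=1,\qquad g^\natural f=1+(b+Bu^{-1})\varphi^\natural+\varphi^\natural(b+Bu^{-1}),\qquad f\varphi^\natural=0 .$$ This provides an $S$-deformation retract of $C^\natural$ to $\bar C^\natural$ and a $T$-deformation retract of $C^\sharp$ to $\bar C^\sharp$ (here $T=1$, so the latter is an ordinary deformation retract of $\mathbb Z/2$-graded complexes).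
   Context: $k$ is a unital ring, not assumed commutative; $k$-modules are left modules. A mixed complex $(C_\bullet,b,B)$ consists of $k$-modules $C_m$ ($m\ge0$) and $k$-linear maps $b:C_\bullet\to C_{\bullet-1}$, $B:C_\bullet\to C_{\bullet+1}$ with $b^2=0$, $B^2=0$, $bB+Bb=0$. Put $C^\natural_m=\bigoplus_{p\ge0,\,2p\le m}C_{m-2p}u^p$, $u$ a formal variable; $u^{-1}(xu^p)=xu^{p-1}$ for $p\ge1$, $u^{-1}(xu^0)=0$; other operators (including $f$) act on coefficients. $C^\natural=(C^\natural_\bullet,b+Bu^{-1},u^{-1})$ is then a chain complex together with a chain map $u^{-1}$ of degree $-2$. An $S$-map between such is a chain map commuting with $u^{-1}$. A co-extension of a map $g$ commuting with $b$ is an $S$-map of the form $g^{(0)}+g^{(1)}u^{-1}+\cdots$ with $g^{(j)}:\bar C_\bullet\to C_{\bullet+2j}$ and $g^{(0)}=g$. An $S$-deformation retract of $C^\natural$ to $\bar C^\natural$ is given by $S$-maps $F:C^\natural_\bullet\to\bar C^\natural_\bullet$, $G:\bar C^\natural_\bullet\to C^\natural_\bullet$ with $FG=1$ and $GF$ chain homotopic to $1$ via a $k$-linear homotopy commuting with $u^{-1}$. The periodic complex is $C^\sharp=(C_0^\sharp\oplus C_1^\sharp,b+B)$ with $C_i^\sharp=\prod_{q\ge0}C_{2q+i}$, $i=0,1$. Definitions: $\varphi^\natural=\sum_{j\ge0}\varphi(B\varphi)^ju^{-j}:C^\natural_\bullet\to C^\natural_{\bullet+1}$; $g^\natural=g+\sum_{j\ge1}(\varphi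 B)^jg\,u^{-j}$. *)

(* Defs.v *)
From HB Require Import structures.
From mathcomp Require Import all_boot all_order all_algebra.
From mathcomp Require Import boolp.

Set Implicit Arguments.
Unset Strict Implicit.
Unset Printing Implicit Defensive.

Import GRing.Theory.
Local Open Scope ring_scope.

(* The library only has the non-dependent pointwise structure on [I -> V]. *)
Section ProdModule.
Variables (k : pzRingType) (I : Type) (M : I -> lmodType k).

Definition prodm : Type := forall i, M i.

HB.instance Definition _ := gen_eqMixin prodm.
HB.instance Definition _ := gen_choiceMixin prodm.

Let zero : prodm := fun=> 0.
Let opp (x : prodm) : prodm := fun i => - x i.
Let add (x y : prodm) : prodm := fun i => x i + y i.
Let scale (a : k) (x : prodm) : prodm := fun i => a *: x i.

Let addA : associative add.
Proof. by move=> x y z; apply: functional_extensionality_dep => i; exact: addrA. Qed.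
Let addC : commutative add.
Proof. by move=> x y; apply: functional_extensionality_dep => i; exact: addrC. Qed.
Let add0 : left_id zero add.
Proof. by move=> x; apply: functional_extensionality_dep => i; exact: add0r. Qed.
Let addN : left_inverse zero opp add.
Proof. by move=> x; apply: functional_extensionality_dep => i; exact: addNr. Qed.

HB.instance Definition _ := GRing.isZmodule.Build prodm addA addC add0 addN.

Let scaleA a b x : scale a (scale b x) = scale (a * b) x.
Proof. by apply: functional_extensionality_dep => i; exact: scalerA. Qed.
Let scale1 : left_id 1 scale.
Proof. by move=> x; apply: functional_extensionality_dep => i; exact: scale1r. Qed.
Let scaleDr : right_distributive scale +%R.
Proof. by move=> a x y; apply: functional_extensionality_dep => i; exact: scalerDr. Qed.
Let scaleDl x : {morph scale^~ x : a b / a + b}.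
Proof. by move=> a b; apply: functional_extensionality_dep => i; exact: scalerDl. Qed.

HB.instance Definition _ :=
  GRing.Zmodule_isLmodule.Build k prodm scaleA scale1 scaleDr scaleDl.

Lemma prodmP (x y : prodm) : (forall i, x i = y i) -> x = y.
Proof. exact: functional_extensionality_dep. Qed.

Lemma prodm0E i : (0 : prodm) i = 0. Proof. by []. Qed.
Lemma prodmDE (x y : prodm) i : (x + y) i = x i + y i. Proof. by []. Qed.
Lemma prodmNE (x : prodm) i : (- x) i = - x i. Proof. by []. Qed.
Lemma prodmZE a (x : prodm) i : (a *: x) i = a *: x i. Proof. by []. Qed.

Lemma prodm_sumE J (r : seq J) (P : pred J) (F : J -> prodm) i :
  (\sum_(j <- r | P j) F j) i = \sum_(j <- r | P j) F j i.
Proof. by elim/big_rec2: _ => // j y x _ <-. Qed.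

End ProdModule.

(* A map of degree [e] is a family [forall n, {linear C n -> D (e + n)}]; for
   closed [e] the index [e + n] computes, so [C n.+1] is [C (1 + n)] and
   [C (j.+1.*2 + n)] is [C (j.*2 + n).+2] by conversion. *)

(* The composite [h o d] where [d] has degree -1 and vanishes on degree 0. *)
Definition after_d (k : pzRingType) (X Y : nat -> lmodType k)
    (h : forall m, {linear X m -> Y m.+1})
    (d : forall m, {linear X m.+1 -> X m}) (m : nat) : X m -> Y m :=
  match m return X m -> Y m with
  | 0 => fun=> 0
  | n.+1 => fun x => h n (d n x)
  end.

Record mixedComplex (k : pzRingType) := MixedComplex {
  mc_obj :> nat -> lmodType k;
  mc_b : forall m, {linear mc_obj m.+1 -> mc_obj m};
  mc_B : forall m, {linear mc_obj m -> mc_obj m.+1};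
  mc_bb : forall m x, mc_b m (mc_b m.+1 x) = 0;
  mc_BB : forall m x, mc_B m.+1 (mc_B m x) = 0;
  mc_bB : forall m x, mc_b m (mc_B m x) + after_d mc_B mc_b x = 0
}.

Section TotalOperators.
Variable k : pzRingType.

(* [raise_fun e h] applies the degree [e] map [h] to every homogeneous
   component: the component in degree [e + n] of the result is [h n (x n)], and
   the components in degrees smaller than [e] vanish. *)
Fixpoint raise_fun (C : nat -> lmodType k) (e : nat) : forall D : nat -> lmodType k,
    (forall n, {linear C n -> D (e + n)%N}) -> prodm C -> prodm D :=
  match e return forall D : nat -> lmodType k,
    (forall n, {linear C n -> D (e + n)%N}) -> prodm C -> prodm D with
  | 0 => fun D h x n => h n (x n)
  | e'.+1 => fun D h x n =>
      match n return D n with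
      | 0 => 0
      | n'.+1 => @raise_fun C e' (fun i => D i.+1) h x n'
      end
  end.

Lemma raise_linear (C : nat -> lmodType k) e (D : nat -> lmodType k)
    (h : forall n, {linear C n -> D (e + n)%N}) :
  linear (raise_fun h).
Proof.
elim: e => [|e IHe] in D h * => a x y; apply: prodmP => n.
  by rewrite /= linearP.
case: n => [|n]; first by rewrite prodmDE prodmZE /= scaler0 addr0.
exact: (congr1 (fun z => z n) (IHe (fun i => D i.+1) h a x y)).
Qed.

Definition raise (C : nat -> lmodType k) e (D : nat -> lmodType k)
    (h : forall n, {linear C n -> D (e + n)%N}) :
    prodm C -> prodm D := raise_fun h.

HB.instance Definition _ (C : nat -> lmodType k) e (D : nat -> lmodType k)
    (h : forall n, {linear C n -> D (e + n)%N}) :=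
  GRing.isLinear.Build k (prodm C) (prodm D) *:%R (raise h) (raise_linear h).

Variable C : mixedComplex k.

Definition tot_b (x : prodm C) : prodm C := fun n => mc_b C n (x n.+1).

Lemma tot_b_linear : linear tot_b.
Proof. by move=> a x y; apply: prodmP => n; rewrite /tot_b /= linearP. Qed.

HB.instance Definition _ :=
  GRing.isLinear.Build k (prodm C) (prodm C) *:%R tot_b tot_b_linear.

Definition tot_B : prodm C -> prodm C := @raise C 1 C (mc_B C).

HB.instance Definition _ :=
  GRing.isLinear.Build k (prodm C) (prodm C) *:%R tot_B
    (raise_linear (mc_B C : forall n, {linear C n -> C (1 + n)%N})).

Lemma tot_bb x : tot_b (tot_b x) = 0.
Proof. by apply: prodmP => n; rewrite /tot_b mc_bb. Qed.

Lemma tot_BB x : tot_B (tot_B x) = 0.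
Proof.
apply: prodmP => -[|[|n]] //=; first by rewrite /tot_B /raise /= linear0.
by rewrite /tot_B /raise /= mc_BB.
Qed.

Lemma tot_bB x : tot_b (tot_B x) + tot_B (tot_b x) = 0.
Proof.
apply: prodmP => n; rewrite prodmDE /= /tot_b /tot_B /raise /= -[RHS](mc_bB (x n)).
by case: n.
Qed.

Lemma raise_eq0 (C' : nat -> lmodType k) e (D : nat -> lmodType k)
    (h : forall n, {linear C' n -> D (e + n)%N}) (x : prodm C') i :
  (forall n, i = (e + n)%N -> x n = 0) -> raise h x i = 0.
Proof.
rewrite /raise; elim: e => [|e IHe] in D h i *.
  by move=> /(_ i erefl) /= ->; rewrite linear0.
case: i => [//|i] x0 /=; apply: IHe => n ein; apply: x0.
by rewrite ein addSn.
Qed.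

End TotalOperators.

Section PowerSeries.
Variable k : pzRingType.

(* [x p] is the coefficient of [u ^ p]. *)
Definition useries (C : nat -> lmodType k) := prodm (fun _ : nat => prodm C).

HB.instance Definition _ C := GRing.Lmodule.on (useries C).

Variables C D : nat -> lmodType k.

Lemma useriesDE (x y : useries C) p : (x + y) p = x p + y p.
Proof. by []. Qed.
Lemma useriesZE a (x : useries C) p : (a *: x) p = a *: x p.
Proof. by []. Qed.

Lemma useries_sumE J (r : seq J) (P : pred J) (F : J -> useries C) p :
  (\sum_(j <- r | P j) F j) p = \sum_(j <- r | P j) F j p.
Proof. by elim/big_rec2: _ => // j y x _ <-. Qed.

Definition uinv (x : useries C) : useries C := fun p => x p.+1.

Lemma uinv_linear : linear uinv.
Proof. by []. Qed.

HB.instance Definition _ :=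
  GRing.isLinear.Build k (useries C) (useries C) *:%R uinv uinv_linear.

Definition coefwise (T : {linear prodm C -> prodm D}) (x : useries C) :
  useries D := fun p => T (x p).

Lemma coefwise_linear T : linear (coefwise T).
Proof. by move=> a x y; apply: prodmP => p; rewrite /coefwise /= linearP. Qed.

HB.instance Definition _ T :=
  GRing.isLinear.Build k (useries C) (useries D) *:%R (coefwise T)
    (coefwise_linear T).

Lemma iter_uinvE j (x : useries C) p : iter j uinv x p = x (j + p)%N.
Proof.
by elim: j p => [//|j IHj] p; rewrite iterS /uinv IHj addSn addnS.
Qed.

Lemma iter_uinv_linear j : linear (iter j uinv).
Proof.
by move=> a x y; apply: prodmP => p; rewrite useriesDE useriesZE !iter_uinvE.
Qed.

End PowerSeries.

(* An S-complex: a chain complex in degrees >= 0 with a chain map [sc_S] of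
   degree -2; [sc_S] is implicitly zero on degrees 0 and 1. *)
Record Scomplex (k : pzRingType) := SComplex {
  sc_obj :> nat -> lmodType k;
  sc_d : forall m, {linear sc_obj m.+1 -> sc_obj m};
  sc_S : forall m, {linear sc_obj m.+2 -> sc_obj m};
  sc_dd : forall m x, sc_d m (sc_d m.+1 x) = 0;
  sc_dS : forall m x, sc_d m (sc_S m.+1 x) = sc_S m (sc_d m.+2 x)
}.

Section Natural.
Variable k : pzRingType.

Section Module.
Variables (C : nat -> lmodType k) (m : nat).

(* The sums of monomials [c u ^ p] with [c] in [C n] and [n + 2 p = m]. *)
Definition udeg : {pred useries C} :=
  fun x => `[< forall p n, (n + p.*2)%N != m -> x p n = 0 >].

Lemma udegP x :
  reflect (forall p n, (n + p.*2)%N != m -> x p n = 0) (x \in udeg).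
Proof. exact: asboolP. Qed.

Lemma udeg_submod : submod_closed udeg.
Proof.
split=> [|a x y /udegP hx /udegP hy]; apply/udegP => p n e //.
by rewrite useriesDE useriesZE prodmDE prodmZE hx // hy // scaler0 addr0.
Qed.

HB.instance Definition _ :=
  GRing.isSubmodClosed.Build k (useries C) udeg
    (GRing.submod_closed_semi udeg_submod).
HB.instance Definition _ :=
  GRing.isOppClosed.Build (useries C) udeg
    (GRing.zmod_closedN (GRing.submod_closedB udeg_submod)).

Record natm := NatM { natval : useries C; natvalP : natval \in udeg }.

HB.instance Definition _ := [isSub for natval].
HB.instance Definition _ := [Choice of natm by <:].
HB.instance Definition _ := [SubChoice_isSubZmodule of natm by <:].
HB.instance Definition _ := [SubZmodule_isSubLmodule of natm by <:].

End Module.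

Section Lift.
Variables (C D : nat -> lmodType k) (m m' : nat) (T : useries C -> useries D).
Hypothesis Tlin : linear T.
Hypothesis Tdeg : forall x, x \in @udeg C m -> T x \in @udeg D m'.

Definition natlift_fun (x : natm C m) : natm D m' := NatM (Tdeg (natvalP x)).

Lemma natlift_linear : linear natlift_fun.
Proof. by move=> a x y; apply: val_inj; rewrite /= Tlin. Qed.

Definition natlift : {linear natm C m -> natm D m'} :=
  HB.pack natlift_fun (GRing.isLinear.Build _ _ _ _ _ natlift_linear).

End Lift.

Section Complex.
Variable C : mixedComplex k.

(* The differential b + B u^-1. *)
Definition u_d (x : useries C) : useries C :=
  coefwise (@tot_b k C) x + coefwise (@tot_B k C) (uinv x).

Lemma u_d_linear : linear u_d.
Proof. by move=> a x y; rewrite /u_d !linearP scalerDr addrACA. Qed.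

Lemma u_d_deg m x : x \in @udeg C m.+1 -> u_d x \in @udeg C m.
Proof.
move=> /udegP hx; apply/udegP => p n e; rewrite /u_d useriesDE prodmDE.
rewrite [X in X + _](_ : _ = 0); last first.
  by rewrite /coefwise /= /tot_b hx ?linear0 // addSn eqSS.
rewrite add0r; apply: raise_eq0 => n' en; apply: hx; apply: contra e.
by rewrite en doubleS !addnS eqSS.
Qed.

Lemma uinv_deg m x : x \in @udeg C m.+2 -> uinv x \in @udeg C m.
Proof.
move=> /udegP hx; apply/udegP => p n e.
by apply: hx; rewrite doubleS !addnS !eqSS.
Qed.

Definition nat_d m : {linear natm C m.+1 -> natm C m} :=
  natlift u_d_linear (@u_d_deg m).

Definition nat_uinv m : {linear natm C m.+2 -> natm C m} :=
  natlift (@uinv_linear k C) (@uinv_deg m).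

Lemma nat_dd m x : nat_d m (nat_d m.+1 x) = 0.
Proof.
apply: val_inj; apply: prodmP => p.
rewrite /= /u_d /coefwise !useriesDE /uinv !useriesDE !linearD /= tot_bb add0r.
by rewrite tot_BB addr0 tot_bB.
Qed.

Lemma nat_d_uinv m x : nat_d m (nat_uinv m.+1 x) = nat_uinv m (nat_d m.+2 x).
Proof. exact: val_inj. Qed.

Definition natC : Scomplex k := SComplex nat_dd nat_d_uinv.

End Complex.

Section Operators.
Variables C D : nat -> lmodType k.

(* The map [sum_(j >= 0) h_j u ^ -j] of degree [e], for [h_j] of degree
   [e + 2 j].  On [natm C m] one has [u ^ -j = 0] as soon as [j > m]. *)
Definition useries_op e (h : forall j n, {linear C n -> D (e + j.*2 + n)%N}) m
    (x : useries C) : useries D :=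
  \sum_(j < m.+1) coefwise (raise (h j)) (iter j (@uinv k C) x).

Lemma useries_op_linear e (h : forall j n, {linear C n -> D (e + j.*2 + n)%N}) m :
  linear (useries_op h m).
Proof.
move=> a x y; rewrite /useries_op scaler_sumr -big_split /=.
by apply: eq_bigr => j _; rewrite iter_uinv_linear linearP.
Qed.

Lemma useries_op_deg e (h : forall j n, {linear C n -> D (e + j.*2 + n)%N}) m x :
  x \in @udeg C m -> useries_op h m x \in @udeg D (e + m)%N.
Proof.
move=> /udegP hx; apply/udegP => p i ne; rewrite /useries_op useries_sumE prodm_sumE.
rewrite big1 // => j _; apply: raise_eq0 => n en.
rewrite iter_uinvE hx //; apply: contra ne => /eqP <-.
by rewrite en doubleD -!addnA (addnCA n).
Qed.

Definition nat_series e (h : forall j n, {linear C n -> D (e + j.*2 + n)%N}) m :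
    {linear natm C m -> natm D (e + m)%N} :=
  natlift (useries_op_linear h m) (@useries_op_deg e h m).

Variable f : forall n, {linear C n -> D n}.

Definition tot_map : {linear prodm C -> prodm D} := @raise k C 0 D f.

Lemma coefwise_deg m x : x \in @udeg C m -> coefwise tot_map x \in @udeg D m.
Proof.
move=> /udegP hx; apply/udegP => p n e.
by apply: raise_eq0 => n' en; apply: hx; rewrite -[n']add0n -en.
Qed.

Definition nat_map m : {linear natm C m -> natm D m} :=
  natlift (@coefwise_linear k C D tot_map) (@coefwise_deg m).

End Operators.

End Natural.

Section SMaps.
Variables (k : pzRingType).

Definition S_map (X Y : Scomplex k) (F : forall m, {linear X m -> Y m}) : Prop :=
  (forall m x, F m (sc_d X m x) = sc_d Y m (F m.+1 x)) /\
  (forall m x, F m (sc_S X m x) = sc_S Y m (F m.+2 x)).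

Definition coextension (D C : mixedComplex k) (g : forall n, {linear D n -> C n})
    (G : forall m, {linear natC D m -> natC C m}) : Prop :=
  S_map G /\
  exists gj : forall j n, {linear D n -> C (0 + j.*2 + n)%N},
    (forall n x, gj 0%N n x = g n x) /\
    (forall m x, G m x = nat_series gj m x).

(* The last clause is commutation of [h] with [sc_S] on degree 1, where
   [sc_S] vanishes. *)
Definition S_commuting (X Y : Scomplex k) (h : forall m, {linear X m -> Y m.+1}) :
    Prop :=
  (forall m x, sc_S Y m.+1 (h m.+2 x) = h m (sc_S X m x)) /\
  (forall x, sc_S Y 0 (h 1%N x) = 0).

(* [F] and [G] form an S-deformation retract of [X] to [Y], the homotopy
   from [1] to [G F] being [h]. *)
Definition S_deformation_retract (X Y : Scomplex k)
    (F : forall m, {linear X m -> Y m}) (G : forall m, {linear Y m -> X m})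
    (h : forall m, {linear X m -> X m.+1}) : Prop :=
  [/\ S_map F, S_map G,
      forall m y, F m (G m y) = y,
      forall m x, G m (F m x) = x + sc_d X m (h m x) + after_d h (sc_d X) x
    & S_commuting h].

End SMaps.

(* A Z/2-graded complex is a module which is the direct sum of its submodules
   of even ([z2_gr false]) and odd ([z2_gr true]) elements, together with an
   odd differential. *)
Record Z2complex (k : pzRingType) := Z2Complex {
  z2_obj :> lmodType k;
  z2_gr : bool -> z2_obj -> Prop;
  z2_d : {linear z2_obj -> z2_obj};
  z2_gr0 : forall i, z2_gr i 0;
  z2_grP : forall i a x y, z2_gr i x -> z2_gr i y -> z2_gr i (a *: x + y);
  z2_span : forall x, exists x0 x1, [/\ z2_gr false x0, z2_gr true x1 & x = x0 + x1];
  z2_direct : forall x, z2_gr false x -> z2_gr true x -> x = 0;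
  z2_d_odd : forall i x, z2_gr i x -> z2_gr (~~ i) (z2_d x);
  z2_dd : forall x, z2_d (z2_d x) = 0
}.

Section Z2Maps.
Variables (k : pzRingType).

Definition Z2_map (X Y : Z2complex k) (F : {linear X -> Y}) : Prop :=
  (forall i x, z2_gr i x -> z2_gr i (F x)) /\
  (forall x, F (z2_d X x) = z2_d Y (F x)).

Definition Z2_deformation_retract (X Y : Z2complex k)
    (F : {linear X -> Y}) (G : {linear Y -> X}) (h : {linear X -> X}) : Prop :=
  [/\ Z2_map F, Z2_map G,
      forall y, F (G y) = y,
      forall x, G (F x) = x + z2_d X (h x) + h (z2_d X x)
    & forall i x, z2_gr i x -> z2_gr (~~ i) (h x)].

End Z2Maps.

Section Sharp.
Variable k : pzRingType.

Section Complex.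
Variable C : mixedComplex k.

(* [sharp_gr i] is the product of the [C n] with [n] of parity [i]. *)
Definition sharp_gr (i : bool) (x : prodm C) : Prop :=
  forall n, odd n != i -> x n = 0.

Definition sharp_d : {linear prodm C -> prodm C} := @tot_b k C \+ @tot_B k C.

Lemma sharp_gr0 i : sharp_gr i 0.
Proof. by []. Qed.

Lemma sharp_grP i a x y :
  sharp_gr i x -> sharp_gr i y -> sharp_gr i (a *: x + y).
Proof.
by move=> hx hy n e; rewrite prodmDE prodmZE hx // hy // scaler0 addr0.
Qed.

Lemma sharp_span x :
  exists x0 x1, [/\ sharp_gr false x0, sharp_gr true x1 & x = x0 + x1].
Proof.
exists (fun n => if odd n then 0 else x n), (fun n => if odd n then x n else 0).
split=> [n|n|]; try by case: (odd n).
by apply: prodmP => n; rewrite prodmDE; case: (odd n); rewrite ?add0r ?addr0.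
Qed.

Lemma sharp_direct x : sharp_gr false x -> sharp_gr true x -> x = 0.
Proof.
move=> h0 h1; apply: prodmP => n.
by case: (boolP (odd n)) => on; [apply: h0; rewrite on | apply: h1; rewrite (negPf on)].
Qed.

Lemma sharp_d_odd i x : sharp_gr i x -> sharp_gr (~~ i) (sharp_d x).
Proof.
move=> hx n e; rewrite /= prodmDE [X in X + _](_ : _ = 0); last first.
  by rewrite /tot_b hx ?linear0 //=; apply: contra e; case: (odd n); case: (i).
rewrite add0r; apply: raise_eq0 => n' en; apply: hx.
by apply: contra e; rewrite en /=; case: (odd n'); case: (i).
Qed.

Lemma sharp_dd x : sharp_d (sharp_d x) = 0.
Proof. by rewrite /= !linearD /= tot_bb add0r tot_BB addr0 tot_bB. Qed.

Definition sharpC : Z2complex k :=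
  Z2Complex sharp_gr0 sharp_grP sharp_span sharp_direct sharp_d_odd sharp_dd.

End Complex.

Section Operators.
Variables C D : nat -> lmodType k.

(* The map [sum_(j >= 0) h_j] on products, for [h_j] of degree [e + 2 j]; the
   terms with [j > n] have no component in degree [n]. *)
Definition sharp_series_fun e (h : forall j n, {linear C n -> D (e + j.*2 + n)%N})
    (x : prodm C) : prodm D :=
  fun n => \sum_(j < n.+1) raise (h j) x n.

Lemma sharp_series_linear e (h : forall j n, {linear C n -> D (e + j.*2 + n)%N}) :
  linear (sharp_series_fun h).
Proof.
move=> a x y; apply: prodmP => n.
rewrite prodmDE prodmZE /sharp_series_fun scaler_sumr -big_split /=.
by apply: eq_bigr => j _; rewrite linearP.
Qed.

Definition sharp_series e (h : forall j n, {linear C n -> D (e + j.*2 + n)%N}) :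
    {linear prodm C -> prodm D} :=
  HB.pack (sharp_series_fun h)
    (GRing.isLinear.Build _ _ _ _ _ (sharp_series_linear h)).

End Operators.

End Sharp.

Section Perturbation.
Variables (k : pzRingType) (C D : mixedComplex k).
Variables (f : forall m, {linear C m -> D m}) (g : forall m, {linear D m -> C m}).
Variable phi : forall m, {linear C m -> C m.+1}.

Fixpoint pow2 (h : forall n, {linear C n -> C n.+2}) j n :
    {linear C n -> C (j.*2 + n)%N} :=
  match j return {linear C n -> C (j.*2 + n)%N} with
  | 0 => idfun
  | i.+1 => h (i.*2 + n)%N \o pow2 h i n
  end.

(* phi (B phi)^j *)
Definition phi_coef j n : {linear C n -> C (1 + j.*2 + n)%N} :=
  phi (j.*2 + n)%N \o pow2 (fun i => mc_B C i.+1 \o phi i) j n.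

(* (phi B)^j g *)
Definition g_coef j n : {linear D n -> C (0 + j.*2 + n)%N} :=
  pow2 (fun i => phi i.+1 \o mc_B C i) j n \o g n.

Definition f_nat m : {linear natC C m -> natC D m} := nat_map f m.
Definition g_nat m : {linear natC D m -> natC C m} := nat_series g_coef m.
Definition phi_nat m : {linear natC C m -> natC C m.+1} := nat_series phi_coef m.

(* The maps induced on the periodic complexes, obtained from the above by
   setting [u = 1]. *)
Definition f_sharp : {linear sharpC C -> sharpC D} := tot_map f.
Definition g_sharp : {linear sharpC D -> sharpC C} := sharp_series g_coef.
Definition phi_sharp : {linear sharpC C -> sharpC C} := sharp_series phi_coef.

End Perturbation.

(* Main.v *)
Require Import Defs.
From HB Require Import structures.
From mathcomp Require Import all_boot all_order all_algebra.

Set Implicit Arguments.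
Unset Strict Implicit.
Unset Printing Implicit Defensive.

Import GRing.Theory.
Local Open Scope ring_scope.

(** Everything follows from one identity for operators: on the kernel of [f],
    [b phi B + B = phi B b].  Indeed [gf = 1 + b phi + phi b] applied to [B x]
    gives [b phi B x = g f B x - B x - phi b B x], where [f B x = B f x] vanishes
    with [f x] and [b B = - B b].  Since [f phi = 0], all the terms
    [phi (B phi)^j x], and [(phi B)^j g y] for [j > 0], lie in that kernel, and
    induction on [j] produces the coefficients of [u ^ -j] in the two claims:
[[
      b (phi B)^(j+1) g + B (phi B)^j g = (phi B)^(j+1) g b + (phi B)^j g B,
      (phi B)^(j+1) g f = b Phi_(j+1) + B Phi_j + Phi_(j+1) b + Phi_j B,
]]
    where [Phi_j = phi (B phi)^j].  These are [b_g_termS] and [g_term_fS]; they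
    are proved for additive maps between arbitrary Z-modules, then applied to the
    operators induced on the products of all the [C n] and of all the [D n].

    The natural and the periodic complexes are treated together by summing the
    coefficient identities over [j < N], along a sequence [x 0, x 1, ...] of
    elements ([g_sum_chain], [phi_sum_homotopy]).  Taking for [x j] the coefficient
    of [u ^ (p + j)] gives the coefficient of [u ^ p] of the natural statement; a
    constant sequence means [u = 1], that is, the periodic statement.  The sums
    telescope up to boundary terms at [N], which vanish for [N] large enough: on
    the natural complex because an element is a polynomial in [u], on the periodic
    one because operators of degree at least [N] do not reach the components of
    degree less than [N]. *)

(** * Operator identities for a deformation retract perturbed by [B] *)

Section PerturbationIdentities.

Variables (V W : zmodType) (b B phi : {additive V -> V}).
Variables (b' B' : {additive W -> W}) (f : {additive V -> W}) (g : {additive W -> V}).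

Hypotheses (BB : forall x, B (B x) = 0) (bB : forall x, b (B x) + B (b x) = 0).
Hypotheses (gb : forall y, g (b' y) = b (g y)) (fg : forall y, f (g y) = y).
Hypothesis gf : forall x, g (f x) = x + b (phi x) + phi (b x).
Hypotheses (fB : forall x, f (B x) = B' (f x)) (fphi : forall x, f (phi x) = 0).

Definition phi_term j x := phi (iter j (B \o phi) x).
Definition g_term j y := iter j (phi \o B) (g y).

Lemma iter_additive (h : {additive V -> V}) j : zmod_morphism (iter j h).
Proof. by elim: j => // j IHj x y; rewrite !iterS IHj raddfB. Qed.

Lemma g_term_additive j : zmod_morphism (g_term j).
Proof. by move=> x y; rewrite /g_term raddfB iter_additive. Qed.

Lemma phi_term_additive j : zmod_morphism (phi_term j).
Proof. by move=> x y; rewrite /phi_term iter_additive raddfB. Qed.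

HB.instance Definition _ j :=
  GRing.isZmodMorphism.Build W V (g_term j) (g_term_additive j).
HB.instance Definition _ j :=
  GRing.isZmodMorphism.Build V V (phi_term j) (phi_term_additive j).
HB.instance Definition _ j :=
  GRing.isZmodMorphism.Build V V (iter j (phi \o B)) (iter_additive _ j).

Lemma f_g_term j y : f (g_term j y) = if j is 0 then y else 0.
Proof. by case: j => [|j]; [exact: fg | rewrite /g_term iterS /= fphi]. Qed.

Lemma f_phi_term j x : f (phi_term j x) = 0.
Proof. exact: fphi. Qed.

Lemma phi_termE j x : phi_term j x = iter j (phi \o B) (phi x).
Proof. by rewrite /phi_term; elim: j x => //= j IHj x; rewrite IHj. Qed.

(** The relation [gf = 1 + b phi + phi b] at [B x]; the term [g (B' (f x))] is
    where the hypothesis that [f] commutes with [B] enters. *)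
Lemma b_phiB x : b (phi (B x)) + B x = phi (B (b x)) + g (B' (f x)).
Proof.
have /eqP := bB x; rewrite addr_eq0 => /eqP bBx.
by rewrite -fB gf bBx raddfN /= addrC [RHS]addrC subrK.
Qed.

Lemma b_phiB_ker x : f x = 0 -> b (phi (B x)) + B x = phi (B (b x)).
Proof. by move=> fx; rewrite b_phiB fx !raddf0 addr0. Qed.

Lemma b_g_term0 y : b (g_term 0 y) = g_term 0 (b' y).
Proof. by rewrite /g_term /= gb. Qed.

(** For [j = 0] this is [b_phiB] at [g y].  Each further factor [phi B] is moved
    across [b] by [b_phiB_ker], and [B B = 0] removes the extra terms. *)
Lemma b_g_termS j y :
  b (g_term j.+1 y) + B (g_term j y) = g_term j.+1 (b' y) + g_term j (B' y).
Proof.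
elim: j => [|j IHj]; first by rewrite /g_term /= b_phiB gb fg.
rewrite [g_term j.+2 y]iterS /= b_phiB_ker ?f_g_term //.
have /eqP := IHj; rewrite eq_sym -subr_eq => /eqP <-.
by rewrite !(raddfB, raddfD) /= BB raddf0 subr0.
Qed.

Lemma b_phi_termS j x :
  b (phi_term j.+1 x) + B (phi_term j x) = iter j.+1 (phi \o B) (b (phi x)).
Proof.
elim: j => [|j IHj]; first by rewrite b_phiB_ker ?f_phi_term.
rewrite iterS -IHj /= b_phiB_ker ?f_phi_term //.
by rewrite raddfD /= BB addr0.
Qed.

Lemma g_term_f0 x : g_term 0 (f x) = x + b (phi_term 0 x) + phi_term 0 (b x).
Proof. exact: gf. Qed.

(** Expand [g f] in [(phi B)^(j+1) g f]: the summand coming from [b phi] is given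
    by [b_phi_termS], the two others are [phi_term j (B x)] and
    [phi_term j.+1 (b x)]. *)
Lemma g_term_fS j x :
  g_term j.+1 (f x) = (b (phi_term j.+1 x) + B (phi_term j x))
    + (phi_term j.+1 (b x) + phi_term j (B x)).
Proof.
rewrite b_phi_termS /g_term gf !phi_termE -iterSr !raddfD /=.
by rewrite -addrA addrC -addrA.
Qed.

Lemma sum_shift (U : zmodType) N (F G : nat -> U) :
  \sum_(j < N.+1) (F j + G j) = F 0%N + \sum_(j < N) (F j.+1 + G j) + G N.
Proof. by rewrite !big_split /= big_ord_recl big_ord_recr /= !addrA. Qed.

(** The series [g + phi B g u^-1 + ...] is a chain map, up to the truncation: read
    [y j] as a coefficient of a series in [u] and [y' j] as the same coefficient
    after multiplication by [u^-1]. *)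
Lemma g_sum_chain N (y y' : nat -> W) : (forall j, y j.+1 = y' j) ->
  \sum_(j < N.+1) g_term j (b' (y j) + B' (y' j)) + B (g_term N (y' N)) =
  b (\sum_(j < N.+1) g_term j (y j)) + B (\sum_(j < N.+1) g_term j (y' j))
    + g_term N (B' (y' N)).
Proof.
move=> yS; rewrite !raddf_sum -big_split /=.
under eq_bigr => j _ do rewrite (raddfD (g_term j)).
rewrite (sum_shift N (fun j => g_term j (b' (y j)))
  (fun j => g_term j (B' (y' j)))).
rewrite (sum_shift N (fun j => b (g_term j (y j)))
  (fun j => B (g_term j (y' j)))).
rewrite b_g_term0 addrAC; do 3 congr (_ + _).
by apply: eq_bigr => j _; rewrite yS b_g_termS.
Qed.

(** The homotopy from [1] to the composite of the series of [g] with [f], again up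
    to the truncation. *)
Lemma phi_sum_homotopy N (x x' : nat -> V) : (forall j, x j.+1 = x' j) ->
  \sum_(j < N.+1) g_term j (f (x j))
    + (B (phi_term N (x' N)) + phi_term N (B (x' N))) =
  x 0%N + (b (\sum_(j < N.+1) phi_term j (x j))
             + B (\sum_(j < N.+1) phi_term j (x' j)))
    + \sum_(j < N.+1) phi_term j (b (x j) + B (x' j)).
Proof.
move=> xS; rewrite !raddf_sum -big_split /=.
under [in X in _ = _ + X]eq_bigr => j _ do rewrite (raddfD (phi_term j)).
rewrite -addrA -big_split /=.
under [in RHS]eq_bigr => j _ do rewrite addrACA.
rewrite (sum_shift N (fun j => b (phi_term j (x j)) + phi_term j (b (x j)))
  (fun j => B (phi_term j (x' j)) + phi_term j (B (x' j)))).
rewrite big_ord_recl g_term_f0 !addrA; do 3 congr (_ + _).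
by apply: eq_bigr => j _; rewrite lift0 xS g_term_fS addrACA.
Qed.

End PerturbationIdentities.

(** * Graded maps, and truncation of series of operators *)

Section Raise.
Variable k : pzRingType.
Implicit Types C D : nat -> lmodType k.

Lemma raiseE C e D (h : forall n, {linear C n -> D (e + n)%N}) x n :
  raise h x (e + n)%N = h n (x n).
Proof. by elim: e => [|e IHe] in D h * => //; exact: IHe. Qed.

Lemma raise_low C e D (h : forall n, {linear C n -> D (e + n)%N}) x i :
  (i < e)%N -> raise h x i = 0.
Proof.
by move=> ie; apply: raise_eq0 => n ein; move: ie; rewrite ein ltnNge leq_addr.
Qed.

(** This characterization avoids any recursion on the degree, and any transport
    between [C (e + n)] and [C n'], when composites are compared. *)
Lemma raise_uniq C e D (h : forall n, {linear C n -> D (e + n)%N}) x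
    (y : prodm D) :
    (forall i, (i < e)%N -> y i = 0) -> (forall n, y (e + n)%N = h n (x n)) ->
  raise h x = y.
Proof.
move=> ylow yE; apply: prodmP => i; case: (ltnP i e) => ie.
  by rewrite ylow // raise_low.
by rewrite -(subnKC ie) raiseE yE.
Qed.

Lemma raise_pow2 (C : mixedComplex k)
    (s t : forall n, {linear C n -> C (1 + n)%N}) j (x : prodm C) :
  raise (pow2 (fun i => t i.+1 \o s i) j) x = iter j (raise t \o raise s) x.
Proof.
elim: j => [|j IHj]; first exact: raise_uniq.
apply: raise_uniq => [[|[|i]] ie|n] //; rewrite iterS -IHj.
- exact: linear0.
- by rewrite /raise /= -/(raise _ _ _) raise_low ?linear0.
- exact: (congr1 (fun z => t _ (s _ z)) (raiseE _ x n)).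
Qed.

Lemma ltn_doubleS_addl m p : (m < (p + m).+1.*2)%N.
Proof. by rewrite doubleS ltnS leqW // -addnn addnA leq_addl. Qed.

Lemma udeg_gt C m (x : useries C) p : x \in udeg m -> (m < p.*2)%N -> x p = 0.
Proof.
move=> /udegP xm mp; apply: prodmP => n; apply: xm.
by rewrite gtn_eqF // (leq_trans mp) // leq_addl.
Qed.

(** The bound is made independent of the degree [m], so that operators applied in
    the adjacent degrees [m] and [m.+1] can be compared term by term. *)
Lemma useries_op_trunc C D e
    (h : forall j n, {linear C n -> D (e + j.*2 + n)%N}) m N (x : useries C) p :
  x \in udeg m -> (m <= N)%N ->
  useries_op h m x p = \sum_(j < N.+1) raise (h j) (x (p + j)%N).
Proof.
move=> xm mN; rewrite /useries_op useries_sumE.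
rewrite (big_ord_widen N.+1
  (fun j => coefwise (raise (h j)) (iter j (@uinv k C) x) p)) //.
rewrite big_mkcond; apply: eq_bigr => j _ /=.
rewrite /coefwise iter_uinvE (addnC p).
case: ifP => // /negbT; rewrite -leqNgt => mj.
by rewrite (udeg_gt xm) ?linear0 // -addnn (leq_trans mj) // -addnA leq_addr.
Qed.

Lemma sharp_series_trunc C D e
    (h : forall j n, {linear C n -> D (e + j.*2 + n)%N}) N (x : prodm C) n :
  (n <= N)%N -> sharp_series h x n = (\sum_(j < N.+1) raise (h j) x) n.
Proof.
move=> nN; rewrite prodm_sumE /= /sharp_series_fun.
rewrite (big_ord_widen N.+1 (fun j => raise (h j) x n)) //.
rewrite big_mkcond; apply: eq_bigr => j _ /=.
case: ifP => // /negbT; rewrite -leqNgt => nj.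
by rewrite raise_low // (leq_trans nj) // -addnn addnA leq_addl.
Qed.

Lemma sharp_series_gr (C D : mixedComplex k) e
    (h : forall j n, {linear C n -> D (e + j.*2 + n)%N}) i (x : prodm C) :
  sharp_gr i x -> @sharp_gr k D (odd e (+) i) (sharp_series h x).
Proof.
move=> xi n ni; rewrite /= /sharp_series_fun big1 // => j _.
apply: raise_eq0 => l nl; apply: xi; apply: contra ni => /eqP <-.
by rewrite nl !oddD odd_double addbF.
Qed.

Section TotalMaps.
Variables (C D : mixedComplex k) (f : forall m, {linear C m -> D m}).

Lemma tot_map_b : (forall m x, f m (mc_b C m x) = mc_b D m (f m.+1 x)) ->
  forall x, tot_map f (@tot_b k C x) = @tot_b k D (tot_map f x).
Proof. by move=> fb x; apply: prodmP => n; exact: fb. Qed.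

Lemma tot_map_B : (forall m x, f m.+1 (mc_B C m x) = mc_B D m (f m x)) ->
  forall x, tot_map f (@tot_B k C x) = @tot_B k D (tot_map f x).
Proof.
by move=> fB x; apply: prodmP => -[|n]; [exact: linear0 | exact: fB].
Qed.

Lemma tot_B_low (x : prodm C) n :
  (forall i, (i < n)%N -> x i = 0) -> @tot_B k C x n = 0.
Proof. by move=> x0; apply: raise_eq0 => i ni; apply: x0; rewrite ni. Qed.

Lemma sharp_d_local (x y : prodm C) n :
  (forall i, (i <= n.+1)%N -> x i = y i) -> sharp_d C x n = sharp_d C y n.
Proof.
move=> xy; rewrite /= !prodmDE; congr (_ + _); first by rewrite /tot_b xy.
by case: n xy => // n xy; rewrite /tot_B /raise /= xy // -addn2 leq_addr.
Qed.

End TotalMaps.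

End Raise.

(** * The perturbed maps on the natural and periodic complexes *)

Section PerturbedMaps.
Variables (k : pzRingType) (C D : mixedComplex k).
Variables (f : forall m, {linear C m -> D m}) (g : forall m, {linear D m -> C m}).
Variable phi : forall m, {linear C m -> C m.+1}.

Definition tot_phi : {linear prodm C -> prodm C} := @raise k C 1 C phi.

Local Notation b := (@tot_b k C).
Local Notation B := (@tot_B k C).
Local Notation b' := (@tot_b k D).
Local Notation B' := (@tot_B k D).
Local Notation F := (tot_map f).
Local Notation G := (tot_map g).
Local Notation tphi := (phi_term B tot_phi).
Local Notation tg := (g_term B tot_phi G).

Lemma raise_phi_coef j x : raise (phi_coef phi j) x = tphi j x.
Proof.
rewrite /phi_term; have <- := raise_pow2 (C := C) phi (mc_B C) j x.
apply: raise_uniq => [[//|i] ie|n].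
  by rewrite /tot_phi /= /raise /= -/(raise _ _ _) raise_low ?linear0.
exact: (congr1 (fun z => phi _ z) (raiseE _ x n)).
Qed.

Lemma raise_g_coef j y : raise (g_coef g phi j) y = tg j y.
Proof.
rewrite /g_term; have <- := raise_pow2 (C := C) (mc_B C) phi j (G y).
by apply: raise_uniq => [i ie|n]; [rewrite raise_low | rewrite raiseE].
Qed.

Lemma phi_term_low j x n : (n < j)%N -> tphi j x n = 0.
Proof.
move=> nj; rewrite -raise_phi_coef raise_low // (leq_trans nj) //.
by rewrite -addnn addnA leq_addl.
Qed.

Lemma g_term_low j y n : (n < j)%N -> tg j y n = 0.
Proof.
move=> nj; rewrite -raise_g_coef raise_low // (leq_trans nj) //.
by rewrite -addnn leq_addl.
Qed.

Lemma val_phi_nat m N (x : natC C m) p : (m <= N)%N ->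
  val (phi_nat phi m x) p = \sum_(j < N.+1) tphi j (val x (p + j)%N).
Proof.
move=> mN; rewrite /= (useries_op_trunc _ _ (valP x) mN).
by apply: eq_bigr => j _; rewrite raise_phi_coef.
Qed.

Lemma val_g_nat m N (y : natC D m) p : (m <= N)%N ->
  val (g_nat g phi m y) p = \sum_(j < N.+1) tg j (val y (p + j)%N).
Proof.
move=> mN; rewrite /= (useries_op_trunc _ _ (valP y) mN).
by apply: eq_bigr => j _; rewrite raise_g_coef.
Qed.

Lemma phi_sharp_trunc N x n : (n <= N)%N ->
  phi_sharp phi x n = (\sum_(j < N.+1) tphi j x) n.
Proof.
move=> nN; rewrite (sharp_series_trunc _ _ nN).
by congr (_ n); apply: eq_bigr => j _; rewrite raise_phi_coef.
Qed.

Lemma g_sharp_trunc N y n : (n <= N)%N ->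
  g_sharp g phi y n = (\sum_(j < N.+1) tg j y) n.
Proof.
move=> nN; rewrite (sharp_series_trunc _ _ nN).
by congr (_ n); apply: eq_bigr => j _; rewrite raise_g_coef.
Qed.

Lemma val_nat_d (E : mixedComplex k) m (x : natC E m.+1) p :
  val (sc_d (natC E) m x) p = @tot_b k E (val x p) + @tot_B k E (val x p.+1).
Proof. by []. Qed.

Lemma val_nat_S (E : mixedComplex k) m (x : natC E m.+2) p :
  val (sc_S (natC E) m x) p = val x p.+1.
Proof. by []. Qed.

Lemma val_f_nat m (x : natC C m) p : val (f_nat f m x) p = F (val x p).
Proof. by []. Qed.

(** In degree 0 both sides vanish: an element of degree 0 is a constant [c u^0]
    with [c] in [C 0], and [b + B u^-1] kills it. *)
Lemma val_phi_nat_after_d m N (x : natC C m) p : (m <= N)%N ->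
  val (after_d (phi_nat phi) (sc_d (natC C)) x) p =
  \sum_(j < N.+1) tphi j (b (val x (p + j)%N) + B (val x (p + j).+1)).
Proof.
case: m x => [|m] x mN; last by rewrite (val_phi_nat _ _ (ltnW mN)).
have d0 q : b (val x q) + B (val x q.+1) = 0.
  rewrite (udeg_gt (p := q.+1) (valP x)) // raddf0 addr0; apply: prodmP => n.
  by have /udegP x0 := valP x; rewrite /tot_b x0 ?linear0.
by rewrite big1 // => j _; rewrite d0 raddf0.
Qed.

Section Retract.

Hypothesis g_b : forall m (y : D m.+1), g m (mc_b D m y) = mc_b C m (g m.+1 y).
Hypothesis fg : forall m (y : D m), f m (g m y) = y.
Hypothesis gf : forall m (x : C m),
  g m (f m x) = x + mc_b C m (phi m x) + after_d phi (mc_b C) x.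
Hypothesis f_B : forall m (x : C m), f m.+1 (mc_B C m x) = mc_B D m (f m x).
Hypothesis f_phi : forall m (x : C m), f m.+1 (phi m x) = 0.

Lemma tot_fg y : F (G y) = y.
Proof. by apply: prodmP => n; exact: fg. Qed.

Lemma tot_f_phi x : F (tot_phi x) = 0.
Proof. by apply: prodmP => -[|n]; [exact: linear0 | exact: f_phi]. Qed.

Lemma tot_gf x : G (F x) = x + b (tot_phi x) + tot_phi (b x).
Proof. by apply: prodmP => -[|n]; exact: gf. Qed.

Lemma tot_g_sum_chain N (y y' : nat -> prodm D) : (forall j, y j.+1 = y' j) ->
  \sum_(j < N.+1) tg j (b' (y j) + B' (y' j)) + B (tg N (y' N)) =
  b (\sum_(j < N.+1) tg j (y j)) + B (\sum_(j < N.+1) tg j (y' j))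
    + tg N (B' (y' N)).
Proof.
exact: (g_sum_chain (@tot_BB k C) (@tot_bB k C) (tot_map_b g_b) tot_fg tot_gf
  (tot_map_B f_B) tot_f_phi).
Qed.

Lemma tot_phi_sum_homotopy N (x x' : nat -> prodm C) :
    (forall j, x j.+1 = x' j) ->
  \sum_(j < N.+1) tg j (F (x j)) + (B (tphi N (x' N)) + tphi N (B (x' N))) =
  x 0%N + (b (\sum_(j < N.+1) tphi j (x j)) + B (\sum_(j < N.+1) tphi j (x' j)))
    + \sum_(j < N.+1) tphi j (b (x j) + B (x' j)).
Proof.
exact: (phi_sum_homotopy (@tot_BB k C) (@tot_bB k C) tot_gf (tot_map_B f_B)
  tot_f_phi).
Qed.

Lemma tot_f_g_sum N (y : nat -> prodm D) : F (\sum_(j < N.+1) tg j (y j)) = y 0%N.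
Proof.
rewrite raddf_sum big_ord_recl big1 ?addr0 => [|j _].
  by rewrite (f_g_term _ tot_fg tot_f_phi).
by rewrite (f_g_term _ tot_fg tot_f_phi).
Qed.

(** ** The natural complex *)

Lemma g_nat_d m (y : natC D m.+1) :
  g_nat g phi m (sc_d (natC D) m y) = sc_d (natC C) m (g_nat g phi m.+1 y).
Proof.
apply: val_inj; apply: prodmP => p.
rewrite val_nat_d (val_g_nat _ _ (leqnSn m)) !(val_g_nat _ _ (leqnn m.+1)).
have := tot_g_sum_chain m.+1 (y := fun j => val y (p + j)%N)
  (fun j => f_equal (val y) (addnS p j)).
by rewrite (udeg_gt (valP y) (ltn_doubleS_addl _ p)) !raddf0 !addr0.
Qed.

Lemma g_nat_S m (y : natC D m.+2) :
  g_nat g phi m (sc_S (natC D) m y) = sc_S (natC C) m (g_nat g phi m.+2 y).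
Proof.
apply: val_inj; apply: prodmP => p; have mm2 : (m <= m.+2)%N by rewrite ltnW.
by rewrite val_nat_S (val_g_nat _ _ mm2) (val_g_nat _ _ (leqnn m.+2)).
Qed.

Lemma f_nat_g m (y : natC D m) : f_nat f m (g_nat g phi m y) = y.
Proof.
apply: val_inj; apply: prodmP => p.
rewrite val_f_nat (val_g_nat _ _ (leqnn m)).
by rewrite (tot_f_g_sum _ (fun j => val y (p + j)%N)) addn0.
Qed.

Lemma f_nat_phi m (x : natC C m) : f_nat f m.+1 (phi_nat phi m x) = 0.
Proof.
apply: val_inj; apply: prodmP => p.
rewrite val_f_nat (val_phi_nat _ _ (leqnn m)) raddf_sum big1 // => j _.
exact: tot_f_phi.
Qed.

Lemma g_nat_f m (x : natC C m) :
  g_nat g phi m (f_nat f m x) = x + sc_d (natC C) m (phi_nat phi m x)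
    + after_d (phi_nat phi) (sc_d (natC C)) x.
Proof.
apply: val_inj; apply: prodmP => p.
transitivity (val x p + val (sc_d (natC C) m (phi_nat phi m x)) p
  + val (after_d (phi_nat phi) (sc_d (natC C)) x) p); last by [].
rewrite (val_phi_nat_after_d _ _ (leqnn m)) val_nat_d.
rewrite (val_g_nat _ _ (leqnn m)) !(val_phi_nat _ _ (leqnn m)).
have := tot_phi_sum_homotopy m (x := fun j => val x (p + j)%N)
  (fun j => f_equal (val x) (addnS p j)).
by rewrite (udeg_gt (valP x) (ltn_doubleS_addl _ p)) !raddf0 !addr0 addn0.
Qed.

Lemma phi_nat_S : S_commuting (phi_nat phi).
Proof.
split=> [m x|x]; apply: val_inj; apply: prodmP => p; rewrite val_nat_S.
  have mm2 : (m <= m.+2)%N by rewrite ltnW.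
  by rewrite (val_phi_nat _ _ mm2) (val_phi_nat _ _ (leqnn m.+2)).
(* In degree 1 there is no positive power of [u]. *)
rewrite (val_phi_nat _ _ (leqnn 1)) big1 // => j _.
by rewrite (udeg_gt (valP x)) ?raddf0 // addSn doubleS.
Qed.

(** ** The periodic complex *)

Lemma g_sharp_d y : g_sharp g phi (sharp_d D y) = sharp_d C (g_sharp g phi y).
Proof.
apply: prodmP => n; rewrite (g_sharp_trunc _ (leqnSn n)).
rewrite (sharp_d_local (fun i => @g_sharp_trunc n.+1 y i)).
have /(congr1 (fun z => z n)) :=
  tot_g_sum_chain n.+1 (y := fun=> y) (fun=> erefl).
rewrite !prodmDE (tot_B_low (x := tg n.+1 y)) => [|i ni]; last first.
  by rewrite g_term_low ?leqW.
by rewrite g_term_low // !addr0 => ->.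
Qed.

Lemma f_sharp_g y : f_sharp f (g_sharp g phi y) = y.
Proof.
apply: prodmP => n; transitivity (f n (g_sharp g phi y n)); first by [].
rewrite (g_sharp_trunc _ (leqnn n)).
exact: (congr1 (fun z => z n) (tot_f_g_sum n (fun=> y))).
Qed.

Lemma g_sharp_f x :
  g_sharp g phi (f_sharp f x) =
    x + sharp_d C (phi_sharp phi x) + phi_sharp phi (sharp_d C x).
Proof.
apply: prodmP => n; rewrite (g_sharp_trunc _ (leqnSn n)) 2!prodmDE.
rewrite (sharp_d_local (fun i => @phi_sharp_trunc n.+1 x i)).
rewrite (phi_sharp_trunc _ (leqnSn n)).
have /(congr1 (fun z => z n)) :=
  tot_phi_sum_homotopy n.+1 (x := fun=> x) (fun=> erefl).
rewrite !prodmDE (tot_B_low (x := tphi n.+1 x)) => [|i ni]; last first.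
  by rewrite phi_term_low ?leqW.
by rewrite phi_term_low // !addr0 => ->.
Qed.

End Retract.

Section InducedMap.

Hypothesis f_b : forall m (x : C m.+1), f m (mc_b C m x) = mc_b D m (f m.+1 x).
Hypothesis f_B : forall m (x : C m), f m.+1 (mc_B C m x) = mc_B D m (f m x).

Lemma f_nat_S_map : S_map (f_nat f).
Proof.
split=> m x; last exact: val_inj.
apply: val_inj; apply: prodmP => p.
by rewrite val_f_nat !val_nat_d linearD (tot_map_b f_b) (tot_map_B f_B).
Qed.

Lemma f_sharp_Z2_map : Z2_map (f_sharp f).
Proof.
split=> [i x xi n ni|x].
  by apply: raise_eq0 => l nl; apply: xi; rewrite -[l]add0n -nl.
by rewrite /f_sharp linearD (tot_map_b f_b) (tot_map_B f_B).
Qed.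

End InducedMap.

End PerturbedMaps.

Theorem lemma7p15 (k : pzRingType) (C D : mixedComplex k)
    (f : forall m, {linear C m -> D m})
    (g : forall m, {linear D m -> C m})
    (phi : forall m, {linear C m -> C m.+1})
    (f_b : forall m (x : C m.+1), f m (mc_b C m x) = mc_b D m (f m.+1 x))
    (g_b : forall m (y : D m.+1), g m (mc_b D m y) = mc_b C m (g m.+1 y))
    (fg : forall m (y : D m), f m (g m y) = y)
    (gf : forall m (x : C m),
        g m (f m x) = x + mc_b C m (phi m x) + after_d phi (mc_b C) x)
    (f_B : forall m (x : C m), f m.+1 (mc_B C m x) = mc_B D m (f m x))
    (f_phi : forall m (x : C m), f m.+1 (phi m x) = 0) :
  [/\ (* (i) *)
      S_map (g_nat g phi) /\ coextension g (g_nat g phi),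
      (* (ii) *)
      [/\ forall m (y : natC D m), f_nat f m (g_nat g phi m y) = y,
          forall m (x : natC C m),
            g_nat g phi m (f_nat f m x) =
              x + sc_d (natC C) m (phi_nat phi m x)
                + after_d (phi_nat phi) (sc_d (natC C)) x
        & forall m (x : natC C m), f_nat f m.+1 (phi_nat phi m x) = 0],
      S_deformation_retract (f_nat f) (g_nat g phi) (phi_nat phi)
    & Z2_deformation_retract (f_sharp f) (g_sharp g phi) (phi_sharp phi)].

Proof.
have g_S_map : S_map (g_nat g phi).
  by split=> m x; [apply: g_nat_d | apply: g_nat_S].
have fgn m y : f_nat f m (g_nat g phi m y) = y by apply: f_nat_g.
have gfn := g_nat_f gf f_B f_phi.
split.
- by split=> //; split=> //; exists (g_coef g phi).
- by split=> // m x; exact: f_nat_phi.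
- by split=> //; [exact: f_nat_S_map | exact: phi_nat_S].
split.
- exact: f_sharp_Z2_map.
- split=> [i y yi|y]; last exact: g_sharp_d.
  exact: (@sharp_series_gr k D C 0 (g_coef g phi) i y yi).
- by apply: f_sharp_g.
- exact: g_sharp_f.
- by move=> i x xi; exact: (sharp_series_gr (phi_coef phi) xi).
Qed.
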